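(* For every maximal outerplanar graph $G$, $$\gamma(G) \leq \min\left\{3\rho(G),\ \tfrac{9}{4}\rho(G) + \tfrac{t}{4}\right\},$$ where $t$ is the number of vertices of degree at most $3$ in $G$.
   Context: All graphs are finite and simple. A graph is outerplanar if it has a plane embedding in which all vertices lie on the boundary of the unbounded face; it is maximal outerplanar if adding any new edge destroys outerplanarity. $\gamma(G)$ is the minimum size of a dominating set of $G$ (a set $X$ such that every vertex not in $X$ has a neighbor in $X$). A packing is a set of vertices with pairwise disjoint closed neighborhoods (equivalently, pairwise distance at least $3$); $\rho(G)$ is the maximum size of a packing. *)

(* Defs.v *)
From mathcomp Require Import all_boot all_order all_algebra.
From mathcomp Require Import all_classical all_reals all_analysis.

Set Implicit Arguments.
Unset Strict Implicit.
Unset Printing Implicit Defensive.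

Import Order.TTheory GRing.Theory Num.Theory.
Import numFieldNormedType.Exports.

(* A finite simple graph is a symmetric irreflexive relation e : rel T on a
   finType T; both properties are hypotheses of the statements using it. *)

Section GraphInvariants.
Variables (T : finType) (e : rel T).
Implicit Types (u v : T) (X : {set T}).

Definition neighborhood v : {set T} := [set u | e v u]%SET.

Definition closed_neighborhood v : {set T} := (v |: neighborhood v)%SET.

Definition degree v : nat := #|neighborhood v|.

Definition dominating X : bool :=
  [forall v, (v \notin X) ==> [exists u in X, e v u]].

Definition domination_number : nat :=
  #|[arg min_(X < [set: T]%SET | dominating X) #|X| ]%N|.

Definition packing X : bool :=
  [forall u in X, forall v in X, (u != v) ==>
    [disjoint closed_neighborhood u & closed_neighborhood v]].

Definition packing_number : nat := (\max_(X : {set T} | packing X) #|X|)%N.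

Definition num_degree_le (k : nat) : nat := #|[set v | degree v <= k]%SET|.

Definition add_edge u v : rel T :=
  fun x y => [|| e x y, (x == u) && (y == v) | (x == v) && (y == u)].

End GraphInvariants.

Section PlaneEmbedding.
Local Open Scope classical_set_scope.
Local Open Scope ring_scope.
Variable R : realType.

Definition is_arc (A : set (R * R)) (x y : R * R) : Prop :=
  exists g : R -> R * R,
    [/\ {within `[0, 1], continuous g},
        set_inj `[0, 1] g,
        g 0 = x, g 1 = y & A = g @` `[0, 1]].

(* pos v is the point representing v, and arc [set u; v] is the closed arc
   (endpoints included) representing the edge uv; the values of arc on sets
   that are not edges are irrelevant. *)
Record plane_embedding (T : finType) (e : rel T)
    (pos : T -> R * R) (arc : {set T} -> set (R * R)) : Prop := {
  pos_inj : injective pos;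
  arc_ends : forall u v : T,
    e u v -> is_arc (arc [set u; v]%SET) (pos u) (pos v);
  arc_avoids_vertices : forall u v w : T,
    e u v -> arc [set u; v]%SET (pos w) -> w = u \/ w = v;
  arcs_meet_at_vertices : forall u v x y : T,
    e u v -> e x y -> [set u; v]%SET != [set x; y]%SET ->
    arc [set u; v]%SET `&` arc [set x; y]%SET `<=` range pos
}.

Definition drawing (T : finType) (e : rel T)
    (pos : T -> R * R) (arc : {set T} -> set (R * R)) : set (R * R) :=
  range pos `|` [set z | exists u v : T, e u v /\ arc [set u; v]%SET z].

Definition is_face (D F : set (R * R)) : Prop :=
  exists2 z, (~` D) z & F = connected_component (~` D) z.

Definition boundary (F : set (R * R)) : set (R * R) :=
  closure F `\` interior F.

Definition outerplanar (T : finType) (e : rel T) : Prop :=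
  exists (pos : T -> R * R) (arc : {set T} -> set (R * R)),
    plane_embedding e pos arc /\
    exists F : set (R * R),
      [/\ is_face (drawing e pos arc) F,
          ~ bounded_set F
        & forall v : T, boundary F (pos v)].

Definition maximal_outerplanar (T : finType) (e : rel T) : Prop :=
  outerplanar e /\
  forall u v : T, u != v -> ~~ e u v -> ~ outerplanar (add_edge e u v).

End PlaneEmbedding.

(* Main.v *)
(* A graph whose vertices have levels such that the neighbours of each vertex
   of level at least its own form a clique of size at most 2 satisfies
   gamma <= 2 rho, which is stronger than both bounds: repeatedly pick an
   undominated vertex v of least level, add it to the packing and add its (at
   most two) parents to the dominating set.  A vertex at distance at most 2 from
   v that is still undominated would be adjacent to v or share with v a child,
   hence would be a parent of v or a neighbour of one.

   A maximal outerplanar graph has such levels because it is a triangulated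
   polygon: the level of a vertex is the length of the innermost edge above it.  To see
   the polygon, a plane embedding with all vertices on one face F is turned into
   a linear order of the vertices in which no two edges cross.  Join a base point
   of F to every vertex inside F (up to a small segment at the end), and replace
   these paths and the edges by walks in a fine grid, the paths forming a tree.
   Two closed grid walks, one shifted by (1/2, 1/2), cross an even number of
   times.  Apply this to the cycles (base, a, b) and (base, c, d) for disjoint
   edges ab and cd: only tree paths cross, and their crossing parities are given
   by the planar left-to-right order of the tree, so that a, b and c, d do not
   interleave in this order.  Conversely, points on a parabola realise every
   noncrossing order by straight chords, so maximality of the graph makes the
   noncrossing order maximal. *)

Require Import Defs.
From mathcomp Require Import all_boot all_order all_algebra.
From mathcomp Require Import all_classical all_reals all_analysis.
From mathcomp Require Import zify ring lra.
Set Implicit Arguments.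
Unset Strict Implicit.
Unset Printing Implicit Defensive.
Import Order.TTheory GRing.Theory Num.Theory.
Import numFieldNormedType.Exports.

(** * Greedy domination against packing *)

Section Greedy.
Variables (T : finType) (e : rel T).
Hypotheses (e_sym : symmetric e) (e_irr : irreflexive e).
Variable l : T -> nat.
(** [p] and [q] may coincide with each other or with [v], which covers vertices with fewer than two
    parents. *)
Hypothesis two_parents : forall v, exists p q,
  [/\ v = p \/ e v p, v = q \/ e v q, p = q \/ e p q
    & forall u, e v u -> l v <= l u -> u = p \/ u = q].

Let dominated (D : {set T}) v := (v \in D) || [exists u in D, e v u].

Let dominated_sub (D D' : {set T}) v :
  D \subset D' -> dominated D v -> dominated D' v.
Proof.
move=> /fintype.subsetP sD /orP[/sD vD|/existsP[u /andP[/sD uD evu]]]; apply/orP.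
  by left.
by right; apply/existsP; exists u; rewrite uD.
Qed.

Let far u v := [disjoint closed_neighborhood e u & closed_neighborhood e v].

Let farP u v :
  reflect (forall w, w = u \/ e u w -> w = v \/ e v w -> False) (far u v).
Proof.
rewrite /far disjoint_subset; apply: (iffP fintype.subsetP) => H w.
  move=> Hu Hv; have := H w; rewrite !inE => /(_ _)/negP; apply.
    by case: Hu => [->|->]; rewrite ?eqxx ?orbT.
  by case: Hv => [->|->]; rewrite ?eqxx ?orbT.
rewrite !inE => Hu; apply/negP => Hv; apply: (H w).
  by case/orP: Hu => [/eqP|]; [left|right].
by case/orP: Hv => [/eqP|]; [left|right].
Qed.

(* [D] grows by the two parents of an undominated vertex [v] of minimal level,
   and [v] joins the packing [A]. *)
Lemma greedy_packing k (D A : {set T}) :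
  #|[set v | ~~ dominated D v]%SET| <= k -> #|D| <= 2 * #|A| ->
  packing e A -> (forall u a, ~~ dominated D u -> a \in A -> far u a) ->
  exists D' A' : {set T},
    [/\ dominating e D', packing e A' & #|D'| <= 2 * #|A'|].
Proof.
elim: k D A => [|k IH] D A Uk DA pA fA.
  exists D, A; split=> //; apply/forallP => v; apply/implyP => vD.
  have : v \notin [set v | ~~ dominated D v]%SET.
    by move: Uk; rewrite leqn0 cards_eq0 => /eqP->; rewrite inE.
  by rewrite inE negbK /dominated (negbTE vD).
have [/existsP[v0 v0U]|/existsPn Dall] := boolP [exists v, ~~ dominated D v];
  last first.
  apply: (IH D A) => //; rewrite (_ : [set _ | _]%SET = finset.set0) ?cards0 //.
  by apply/finset.setP => v; rewrite !inE; apply/negbTE.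
have [v vU vmin] := @arg_minnP _ v0 (fun v => ~~ dominated D v) l v0U.
have [p [q [vp vq pq par]]] := two_parents v.
pose D' := (p |: (q |: D))%SET; pose A' := (v |: A)%SET.
have sD : D \subset D'.
  by apply/fintype.subsetP => w wD; rewrite !inE wD !orbT.
have pD u : u = p \/ e u p -> dominated D' u.
  case=> [->|eup]; first by rewrite /dominated !inE eqxx.
  by apply/orP; right; apply/existsP; exists p; rewrite !inE eqxx.
have qD u : u = q \/ e u q -> dominated D' u.
  case=> [->|euq]; first by rewrite /dominated !inE eqxx orbT.
  by apply/orP; right; apply/existsP; exists q; rewrite !inE eqxx orbT.
have vA : v \notin A.
  by apply/negP => vA; have /farP/(_ v) := fA _ _ vU vA; apply; left.
have nUU u : ~~ dominated D' u -> ~~ dominated D u.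
  exact/contra/dominated_sub.
have farv u : ~~ dominated D' u -> far u v.
  move=> uU; have lvu := vmin _ (nUU _ uU).
  have nevu : ~~ e v u.
    apply/negP => /par/(_ lvu)[E|E]; move/negP: uU; apply.
      by apply: pD; left.
    by apply: qD; left.
  have vDu : u != v by apply: contraNneq uU => ->; apply: pD.
  apply/farP => w [->|euw] [E|evw].
  - by rewrite E eqxx in vDu.
  - by rewrite evw in nevu.
  - by rewrite -E e_sym euw in nevu.
  (* A common neighbour [w] is either a parent of [v], so that [D'] already dominates [u], or of
     lower level than [v] and [u], which are then two parents of [w] and hence adjacent. *)
  have [lvw|lwv] := leqP (l v) (l w).
    have [E|E] := par _ evw lvw; move/negP: uU; apply.
      by apply: pD; right; rewrite -E.
    by apply: qD; right; rewrite -E.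
  have [p' [q' [_ _ pq' par']]] := two_parents w.
  have vP : v = p' \/ v = q' by apply: par'; rewrite 1?e_sym // ltnW.
  have uP : u = p' \/ u = q'.
    by apply: par'; rewrite 1?e_sym //; apply: leq_trans lvu; apply: ltnW.
  move/negP: nevu; apply; move: vDu.
  case: vP => ->; case: uP => ->; rewrite ?eqxx // => vDu.
    by case: pq' => // E; rewrite E eqxx in vDu.
  by rewrite e_sym; case: pq' => // E; rewrite E eqxx in vDu.
apply: (IH D' A').
- rewrite -ltnS; apply: leq_trans Uk; apply: proper_card; apply/properP; split.
    by apply/fintype.subsetP => u; rewrite !inE; apply: nUU.
  by exists v; rewrite !inE ?vU // negbK; apply: pD.
- rewrite /A' cardsU1 vA mulnDr; apply: leq_trans (leq_add (leqnn 2) DA).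
  by rewrite /D' !cardsU1; lia.
- apply/forallP => u; apply/implyP => uA; apply/forallP => w; apply/implyP => wA.
  apply/implyP => uw; move: uA wA; rewrite !inE.
  move=> /orP[/eqP E|uA] /orP[/eqP E'|wA].
  + by rewrite E E' eqxx in uw.
  + by rewrite E; apply: fA.
  + by rewrite E' disjoint_sym; apply: fA.
  + by move/forallP/(_ u)/implyP/(_ uA)/forallP/(_ w)/implyP/(_ wA)/implyP: pA; apply.
- move=> u a uU; rewrite !inE => /orP[/eqP->|aA]; first exact: farv.
  exact: fA (nUU _ uU) aA.
Qed.

Lemma domination_le_twice_packing :
  domination_number e <= 2 * packing_number e.
Proof.
have [D [A [dD pA cDA]]] : exists D A : {set T},
    [/\ dominating e D, packing e A & #|D| <= 2 * #|A|].
  apply: (@greedy_packing #|T| finset.set0 finset.set0) => //.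
  - exact: max_card.
  - by rewrite cards0.
  - by apply/forallP => u; rewrite inE.
  - by move=> u a _; rewrite inE.
rewrite /domination_number; case: arg_minnP => [|X _ /(_ _ dD) le].
  by apply/forallP => v; rewrite inE.
apply: leq_trans le _; apply: leq_trans cDA _; rewrite leq_mul2l /=.
exact: (@leq_bigmax_cond _ (packing e) (fun X : {set T} => #|X|)).
Qed.

End Greedy.

(** * Levels in a maximal noncrossing order *)

(** For symmetric [e] edges may be read in either direction, so this one pattern excludes every
    interleaving of two edges. *)
Definition noncrossing (T : finType) (e : rel T) (rk : T -> nat) :=
  forall a b c d, e a b -> e c d -> ~ [/\ rk a < rk c, rk c < rk b & rk b < rk d].

Section Triangulation.
Variables (T : finType) (e : rel T) (rk : T -> nat).
Hypotheses (e_sym : symmetric e) (e_irr : irreflexive e).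
Hypotheses (rk_inj : injective rk) (ncr : noncrossing e rk).
(** Maximality in terms of the order: a missing edge is crossed by an existing one, which leaves the
    interval to the left or to the right. *)
Hypothesis maxl : forall u v, rk u < rk v -> ~~ e u v -> exists c d, e c d /\
  ([/\ rk c < rk u, rk u < rk d & rk d < rk v] \/
   [/\ rk u < rk c, rk c < rk v & rk v < rk d]).

Let covers v (pq : T * T) := [&& e pq.1 pq.2, rk pq.1 < rk v & rk v < rk pq.2].

(** Exceeds every rank: subtraction from it turns the maximum in [cover_length] into a minimum, with
    value [top] for vertices under no edge. *)
Let top := (\sum_u rk u).+1.

(* Length of the innermost edge above [v] when one exists. *)
Definition cover_length v : nat :=
  top - \max_(pq | covers v pq) (top - (rk pq.2 - rk pq.1)).

Let top_gt u : rk u < top.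
Proof. by rewrite /top (bigD1 u) //=; lia. Qed.

Let cover_length_min v pq : covers v pq -> cover_length v <= rk pq.2 - rk pq.1.
Proof.
move=> H; have := @leq_bigmax_cond _ (covers v)
  (fun pq => top - (rk pq.2 - rk pq.1)) _ H.
by have := top_gt pq.2; rewrite /cover_length; lia.
Qed.

Let cover_length_ex v : (exists pq, covers v pq) ->
  exists2 pq, covers v pq & cover_length v = rk pq.2 - rk pq.1.
Proof.
case=> pq0 c0; have [pq c m] := @arg_minnP _ pq0 (covers v)
  (fun pq => rk pq.2 - rk pq.1) c0.
exists pq => //; apply/eqP; rewrite eqn_leq cover_length_min //=.
have : \max_(pq | covers v pq) (top - (rk pq.2 - rk pq.1)) <=
    top - (rk pq.2 - rk pq.1) by apply/bigmax_leqP => xy /m; lia.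
by have := top_gt pq.2; rewrite /cover_length; lia.
Qed.

Let rk_total u v : u != v -> rk u < rk v \/ rk v < rk u.
Proof.
by move=> uv; case: (ltngtP (rk u) (rk v)) => [|| /rk_inj E]; auto; rewrite E eqxx in uv.
Qed.

(** Third vertex of the triangle below pq: the last neighbour [w] of [p] before [q]. An edge
    crossing wq would cross pq or pw, or would join [p] to a vertex beyond [w]. *)
Let apex p q : e p q -> (exists v, covers v (p, q)) ->
  exists w, [/\ e p w, e w q, rk p < rk w & rk w < rk q].
Proof.
move=> epq [v0 /and3P[/= _ pv0 v0q]].
have [v /andP[pv vq] vmin] := @arg_minnP _ v0
  (fun v => (rk p < rk v) && (rk v < rk q)) rk (introT andP (conj pv0 v0q)).
(* No vertex lies strictly between [p] and [v], so no edge can cross pv. *)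
have epv : e p v.
  apply: contraT => /(maxl pv)[c [d [ecd [[cp pd dv]|[pc cv vd]]]]].
    have := vmin d; rewrite pd (ltn_trans dv vq) => /(_ isT); lia.
  have := vmin c; rewrite pc (ltn_trans cv vq) => /(_ isT); lia.
pose P w := [&& e p w, rk p < rk w & rk w < rk q].
have Pv : P v by rewrite /P epv pv.
have [w /and3P[epw pw wq] wmax] := @arg_maxnP _ v P rk Pv.
exists w; split=> //; apply: contraT => /(maxl wq)[c [d [ecd]]].
case=> [[cw wd dq]|[wc cq qd]]; last first.
  by case: (ncr epq ecd); split=> //; lia.
have [E|cp] := eqVneq c p.
  have : P d by rewrite /P -{1}E ecd dq; lia.
  by move/wmax; rewrite /=; lia.
have [cp'|pc] := rk_total cp.
  by case: (ncr ecd epq); split=> //; lia.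
by case: (ncr epw ecd).
Qed.

(** Under the innermost edge pq over [v], all vertices but the apex [w] lie under pw or wq and have
    smaller level. So [v] is the apex, and noncrossingness keeps its other neighbours under pq, at
    smaller levels. *)
Lemma cover_length_parents v : exists p q,
  [/\ v = p \/ e v p, v = q \/ e v q, p = q \/ e p q
    & forall u, e v u -> cover_length v <= cover_length u -> u = p \/ u = q].
Proof.
have [[pq cpq]|nc] := pselect (exists pq, covers v pq).
  have [[p q] cv lv] := cover_length_ex (ex_intro _ pq cpq).
  have /and3P[/= epq pv vq] := cv.
  have [w [epw ewq pw wq]] := apex epq (ex_intro _ v cv).
  have small u : rk p < rk u -> rk u < rk q -> u != w -> cover_length u < rk q - rk p.
    move=> pu uq uw; have [uw'|wu] := rk_total uw.
      have : covers u (p, w) by rewrite /covers /= epw pu.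
      move/cover_length_min => /=; lia.
    have : covers u (w, q) by rewrite /covers /= ewq wu.
    move/cover_length_min => /=; lia.
  have vw : v = w.
    by apply/eqP; apply: contraT => /(small v pv vq); rewrite lv /= ltnn.
  exists p, q; split; rewrite ?vw; [by right; rewrite e_sym|by right|by right|].
  move=> u ewu; rewrite -vw lv /= => le.
  have [->|up] := eqVneq u p; first by left.
  have [->|uq] := eqVneq u q; first by right.
  have uw : u != w by apply: contraTneq ewu => ->; rewrite e_irr.
  have [pu|pu] := rk_total up.
    by case: (@ncr u w p q) => //; rewrite e_sym.
  have [qu|qu] := rk_total uq; last first.
    by case: (@ncr p q w u) => //; split.
  by have := small u pu qu uw; lia.
(* No edge passes over [v]. As the first and last vertices coincide or are joined, [v] is one of
   them, and only these two reach level [top]. *)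
pose lo := [arg min_(u < v) rk u]; pose hi := [arg max_(u > v) rk u].
have lo_min u : rk lo <= rk u by rewrite /lo; case: arg_minnP => // i _ /(_ u) ->.
have hi_max u : rk u <= rk hi by rewrite /hi; case: arg_maxnP => // i _ /(_ u isT).
have elh : lo = hi \/ e lo hi.
  have [|lh] := eqVneq lo hi; first by left.
  right; apply: contraT => /(maxl _) []; first by case: (rk_total lh) => //; have := lo_min hi; lia.
  by move=> c [d [_ [[+ _ _]|[_ _ +]]]]; have := lo_min c; have := hi_max d; lia.
have ext u : ~ (exists pq, covers u pq) -> u = lo \/ u = hi.
  move=> nu; have [|ul] := eqVneq u lo; first by left.
  have [|uh] := eqVneq u hi; first by right.
  case: elh => [E|elh].
    by left; apply: rk_inj; have := lo_min u; have := hi_max u; rewrite E; lia.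
  case: nu; exists (lo, hi); rewrite /covers elh /=.
  case: (rk_total ul); case: (rk_total uh); have := lo_min u; have := hi_max u; lia.
have lv : cover_length v = top.
  by rewrite /cover_length big_pred0 ?subn0 // => pq; apply/negP => c; apply: nc; exists pq.
exists lo, hi; split=> //.
- case: (ext v nc) => E; first by left.
  by case: elh => E'; [left; rewrite E' | right; rewrite E e_sym].
- case: (ext v nc) => E; last by left.
  by case: elh => E'; [left; rewrite -E' | right; rewrite E].
move=> u _; rewrite lv => le; apply: ext => -[pq cpq].
by have := cover_length_min cpq; have := top_gt pq.2; lia.
Qed.

End Triangulation.

Local Open Scope ring_scope.

(** * Crossing parity of lattice walks *)

Notation zpoint := (int * int)%type.

(* [(vertical, positive)] *)
Notation direction := (bool * bool)%type.

Definition opposite (d : direction) : direction := (d.1, ~~ d.2).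

Definition sgn (b : bool) : int := if b then 1 else -1.

Definition zmove (z : zpoint) (d : direction) : zpoint :=
  if d.1 then (z.1, z.2 + sgn d.2) else (z.1 + sgn d.2, z.2).

Definition walk_end (z : zpoint) (w : seq direction) : zpoint := foldl zmove z w.

(* Lower or left endpoint of the unit edge traversed from [z] along [d]. *)
Definition edge_base (z : zpoint) (d : direction) : zpoint :=
  if d.2 then z else zmove z d.

(* Whether the first edge meets the second one translated by (1/2, 1/2). *)
Definition cross (z : zpoint) (d : direction) (y : zpoint) (f : direction) : bool :=
  [|| [&& ~~ d.1, f.1, (edge_base z d).1 == (edge_base y f).1
        & (edge_base z d).2 == (edge_base y f).2 + 1]
    | [&& d.1, ~~ f.1, (edge_base z d).1 == (edge_base y f).1 + 1
        & (edge_base z d).2 == (edge_base y f).2] ].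

Fixpoint step_crossings z d y (v : seq direction) : bool :=
  if v is f :: v' then cross z d y f (+) step_crossings z d (zmove y f) v'
  else false.

Fixpoint crossings z (w : seq direction) y (v : seq direction) : bool :=
  if w is d :: w' then step_crossings z d y v (+) crossings (zmove z d) w' y v
  else false.

Lemma crossings_catl z w1 w2 y v : crossings z (w1 ++ w2) y v =
  crossings z w1 y v (+) crossings (walk_end z w1) w2 y v.
Proof. by elim: w1 z => //= d w1 IH z; rewrite IH addbA. Qed.

Lemma step_crossings_cat z d y v1 v2 : step_crossings z d y (v1 ++ v2) =
  step_crossings z d y v1 (+) step_crossings z d (walk_end y v1) v2.
Proof. by elim: v1 y => //= f v1 IH y; rewrite IH addbA. Qed.

Lemma crossings_catr z w y v1 v2 : crossings z w y (v1 ++ v2) =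
  crossings z w y v1 (+) crossings z w (walk_end y v1) v2.
Proof.
elim: w z => //= d w IH z; rewrite IH step_crossings_cat.
by rewrite -!addbA; congr (_ (+) _); rewrite addbCA.
Qed.

(* Parity of the crossings with the rightward ray from y + (1/2, 1/2). *)
Fixpoint winding z (w : seq direction) (y : zpoint) : bool :=
  if w is d :: w' then
    [&& d.1, y.1 < (edge_base z d).1 & (edge_base z d).2 == y.2]
    (+) winding (zmove z d) w' y
  else false.

(** Membership of [z] in the half-strip to the right of a vertical edge translated by (1/2, 1/2). *)
Definition ray (y : zpoint) (f : direction) (z : zpoint) : bool :=
  [&& f.1, z.2 == (edge_base y f).2 + 1 & (edge_base y f).1 < z.1].

(** For vertical [f], the translated edge and the rays from its ends bound a half-strip; a walk
    crosses this boundary oddly exactly when just one of its ends lies inside. For horizontal [f],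
    the two rays differ by the translated edge. *)
Lemma crossings_step z w y f : crossings z w y [:: f] =
  winding z w y (+) winding z w (zmove y f) (+) ray y f z (+) ray y f (walk_end z w).
Proof.
elim: w z => [|d w IH] z /=; first by rewrite !addbb.
rewrite IH; set r := ray _ _ (walk_end _ _).
set a := winding _ _ _; set b := winding _ _ _.
suff -> : cross z d y f =
  [&& d.1, y.1 < (edge_base z d).1 & (edge_base z d).2 == y.2] (+)
  [&& d.1, (zmove y f).1 < (edge_base z d).1 & (edge_base z d).2 == (zmove y f).2]
  (+) ray y f z (+) ray y f (zmove z d).
  by case: [&& _, _ & _] a [&& _, _ & _] b (ray _ _ z) (ray _ _ (zmove z d)) r
    => [] [] [] [] [] [] [].
rewrite /cross /ray /edge_base /zmove /sgn.
case: z y d f {IH r a b w} => [z1 z2] [y1 y2] [[] []] [[] []] /=; lia.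
Qed.

(* Up to the winding parities, the crossing parity of [w] with [v] depends on
   [w] only through its ends. *)
Lemma crossings_winding y v : exists q : zpoint -> bool, forall z w,
  crossings z w y v = winding z w y (+) winding z w (walk_end y v) (+) q z
    (+) q (walk_end z w).
Proof.
elim: v y => [|f v IH] y.
  exists (fun=> false) => z w; rewrite /= addbb /=.
  by elim: w z => //= d w IHw z; rewrite IHw.
have [q qE] := IH (zmove y f).
exists (fun x => ray y f x (+) q x) => z w.
rewrite -cat1s crossings_catr crossings_step qE /=.
move: (winding z w y) (winding z w (zmove y f)) (ray y f z) (q z) => a b c d.
move: (ray y f _) (winding z w _) (q _) => g h i.
by case: a b c d g h i => [] [] [] [] [] [] [].
Qed.

(** Winding terms cancel between [v] and [v'], the terms in [q] and [q'] between [w] and [w']: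
    closed walks cross evenly. *)
Lemma crossings_quadrangle z w w' y v v' :
  walk_end z w = walk_end z w' -> walk_end y v = walk_end y v' ->
  crossings z w y v (+) crossings z w y v' (+)
  crossings z w' y v (+) crossings z w' y v' = false.
Proof.
move=> ew ev; have [q qE] := crossings_winding y v.
have [q' qE'] := crossings_winding y v'.
rewrite !qE !qE' ew ev.
move: (winding z w y) (winding z w' y) (q z) (q' z) => a b c d.
move: (winding z w _) (winding z w' _) (q _) (q' _) => f g h i.
by case: a b c d f g h i => [] [] [] [] [] [] [] [].
Qed.

(** * Vertices of walks and disjointness *)

Fixpoint on_walk (z : zpoint) (w : seq direction) (p : zpoint) : Prop :=
  p = z \/ (if w is d :: w' then on_walk (zmove z d) w' p else False).

Lemma on_walk_start z w : on_walk z w z.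
Proof. by case: w => [|d w]; left. Qed.

Lemma on_walk_cat z w1 w2 p : on_walk z (w1 ++ w2) p <->
  on_walk z w1 p \/ on_walk (walk_end z w1) w2 p.
Proof.
elim: w1 z => [|d w1 IH] z /=; last by rewrite IH; tauto.
by split=> [|[[->|//]|//]]; [right|exact: on_walk_start].
Qed.

Lemma on_walkP z w p : on_walk z w p <->
  exists2 i, (i <= size w)%N & p = walk_end z (take i w).
Proof.
elim: w z => [|d w IH] z /=.
  by split=> [[->//|//]|[i _ ->]]; [exists 0%N | left].
rewrite IH; split=> [[->|[i iw ->]]|[[|i] iw ->]].
- by exists 0%N.
- by exists i.+1.
- by left.
- by right; exists i.
Qed.

(** The base of the first edge is the upper or right end of the second. *)
Lemma cross_meet z d y f : cross z d y f ->
  exists2 p, p = z \/ p = zmove z d & p = y \/ p = zmove y f.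
Proof.
rewrite /cross /edge_base /zmove /sgn => c.
exists (edge_base z d); rewrite /edge_base /zmove /sgn;
case: z y d f c => [z1 z2] [y1 y2] [[] []] [[] []] //= c; first [by left | by right | idtac].
all: first [left; congr pair; lia | right; congr pair; lia].
Qed.

Lemma crossings_disjoint z w y v :
  (forall p, on_walk z w p -> on_walk y v p -> False) ->
  crossings z w y v = false.
Proof.
elim: w z => [|d w IH] z //= dis; rewrite IH => [|p pw pv]; last first.
  by apply: dis pv; right.
rewrite addbF; elim: v y dis {IH} => [|f v IH] y //= dis.
rewrite IH => [|p pw pv]; last by apply: (dis p) => //; right.
rewrite addbF; apply/negP => /cross_meet[p pz py]; apply: (dis p).
  by case: pz => ->; [left|right; exact: on_walk_start].
by case: py => ->; [left|right; exact: on_walk_start].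
Qed.

(** * Clockwise order of diverging walks *)

(** For edges leaving a common vertex: right against down, or up against left. *)
Definition vertex_cross (h h' : direction) : bool :=
  [|| [&& ~~ h.1, h.2, h'.1 & ~~ h'.2] | [&& h.1, h.2, ~~ h'.1 & ~~ h'.2]].

(** For distinct directions, [left_or_up a (+) vertex_cross a c] is the linear order left, up,
    right, down. *)
Definition left_or_up (d : direction) : bool := d.1 == d.2.

Lemma cross_in_out z s c : cross z s (zmove z s) c = vertex_cross (opposite s) c.
Proof.
rewrite /cross /vertex_cross /edge_base /zmove /sgn.
by case: z s c => [z1 z2] [[] []] [[] []] /=; lia.
Qed.

Lemma cross_out_in z s a : cross (zmove z s) a z s = vertex_cross a (opposite s).
Proof.
rewrite /cross /vertex_cross /edge_base /zmove /sgn.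
by case: z s a => [z1 z2] [[] []] [[] []] /=; lia.
Qed.

Lemma cross_out_out z a c : cross z a z c = vertex_cross a c.
Proof.
rewrite /cross /vertex_cross /edge_base /zmove /sgn.
by case: z a c => [z1 z2] [[] []] [[] []] /=; lia.
Qed.

(** The walks meet only along a common prefix, as root paths of a tree do; for [w = v] the walk is
    simple. *)
Definition compatible z (w v : seq direction) :=
  forall i j, (i <= size w)%N -> (j <= size v)%N ->
    walk_end z (take i w) = walk_end z (take j v) -> take i w = take j v.

Lemma compatible_tail z d w v :
  compatible z (d :: w) (d :: v) -> compatible (zmove z d) w v.
Proof. by move=> H i j Hi Hj E; have /= := H i.+1 j.+1 Hi Hj E; case. Qed.

(** Clockwise order of the continuations after a step [s], starting from the backward direction
    [opposite s]. *)
Definition turn_lt (s a c : direction) : bool :=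
  left_or_up s (+) vertex_cross (opposite s) c (+) vertex_cross a (opposite s)
  (+) vertex_cross a c.

Fixpoint lex_lt_from s (w v : seq direction) : bool :=
  match w, v with
  | a :: w', c :: v' => if a == c then lex_lt_from a w' v' else turn_lt s a c
  | _, _ => false
  end.

Definition lex_lt (w v : seq direction) : bool :=
  match w, v with
  | a :: w', c :: v' => if a == c then lex_lt_from a w' v'
                        else left_or_up a (+) vertex_cross a c
  | _, _ => false
  end.

Definition forward (s : direction) (w : seq direction) : bool :=
  path (fun s a => a != opposite s) s w.

Lemma zmove_opp z d : zmove (zmove z d) (opposite d) = z.
Proof.
by case: z d => z1 z2 [[] []]; rewrite /zmove /opposite /sgn /=; congr pair; lia.
Qed.

Lemma compatible_forward z s w : compatible z (s :: w) (s :: w) -> forward s w.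
Proof.
elim: w z s => // a w IH z s H; rewrite /forward /= -/(forward a w).
rewrite (IH (zmove z s)) ?andbT; last exact: compatible_tail H.
apply/eqP => E; have := H 0%N 2%N isT isT; rewrite /= E zmove_opp take0.
by move/(_ erefl).
Qed.

(** The walks share only the vertex [z], so only their first edges can cross. *)
Lemma crossings_fork z a w c v :
  compatible z (a :: w) (c :: v) -> a != c ->
  crossings z (a :: w) z (c :: v) = vertex_cross a c.
Proof.
move=> H ac; rewrite -(cat1s a) crossings_catl -(cat1s c) !crossings_catr /=.
rewrite cross_out_out !addbF.
have -> : step_crossings z a (zmove z c) v = false.
  have := @crossings_disjoint z [:: a] (zmove z c) v; rewrite /= addbF; apply.
  move=> p pa /on_walkP[j jv E]; have := H _ j.+1 _ jv; rewrite /= -E.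
  case: pa => [->|[->|//]]; first by move/(_ 0%N isT erefl).
  by move/(_ 1%N isT); rewrite /= take0 => /(_ erefl)[E']; rewrite E' eqxx in ac.
have := @crossings_disjoint (zmove z a) w z (c :: v).
rewrite -(cat1s c) crossings_catr /= => ->; first by rewrite !addbF.
move=> p /on_walkP[i iw E] /(on_walkP z (c :: v))[j jv E'].
have := H i.+1 j iw jv; rewrite /= -E -E' => /(_ erefl).
by case: j {jv E'} => [//|j] [E']; rewrite E' eqxx in ac.
Qed.

(** The common edge counts only at its far end, against the next edge of the other walk; later
    vertices avoid it because each walk is simple. *)
Lemma crossings_common_step z s a w c v :
  compatible z (s :: a :: w) (s :: a :: w) ->
  compatible z (s :: c :: v) (s :: c :: v) ->
  crossings z (s :: a :: w) z (s :: c :: v) =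
  vertex_cross (opposite s) c (+) vertex_cross a (opposite s) (+)
  crossings (zmove z s) (a :: w) (zmove z s) (c :: v).
Proof.
have self z' s' : cross z' s' z' s' = false.
  by rewrite cross_out_out; case: s' => [[] []].
move=> H1 H2; rewrite -(cat1s s (a :: w)) crossings_catl.
rewrite -(cat1s s (c :: v)) !crossings_catr.
have -> : crossings z [:: s] z [:: s] = false by rewrite /= self.
have -> : crossings z [:: s] (walk_end z [:: s]) (c :: v) = vertex_cross (opposite s) c.
  rewrite -(cat1s c v) crossings_catr [X in _ (+) X]crossings_disjoint ?addbF; last first.
    move=> p /on_walkP[i i1 E] /on_walkP[j jv E'].
    have := H2 i j.+2 (leq_trans i1 _) jv; rewrite /= => /(_ isT).
    case: i i1 E => [|[|//]] _ /= E; rewrite ?take0 /= => /(_ (etrans (esym E) E')) //.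
  by rewrite /= addbF cross_in_out addbF.
have -> : crossings (walk_end z [:: s]) (a :: w) z [:: s] = vertex_cross a (opposite s).
  rewrite -(cat1s a) crossings_catl [X in _ (+) X]crossings_disjoint ?addbF; last first.
    move=> p /on_walkP[j jv E'] /on_walkP[i i1 E].
    have := H1 i j.+2 (leq_trans i1 _) jv; rewrite /= => /(_ isT).
    case: i i1 E => [|[|//]] _ /= E; rewrite ?take0 /= => /(_ (etrans (esym E) E')) //.
  by rewrite /= cross_out_in !addbF.
by rewrite addFb addbA.
Qed.

Lemma left_or_up_step s a : a != opposite s ->
  left_or_up s (+) vertex_cross (opposite s) a (+) vertex_cross a (opposite s) = left_or_up a.
Proof. by case: s a => [[] []] [[] []]. Qed.

(* A turn in the common prefix changes the crossing parity exactly when it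
   changes [left_or_up], so that only the fork of the two walks matters. *)
Lemma crossings_lex_from z s w v :
  compatible z (s :: w) (s :: w) -> compatible z (s :: v) (s :: v) ->
  compatible z (s :: w) (s :: v) -> ~~ prefix w v -> ~~ prefix v w ->
  left_or_up s (+) crossings z (s :: w) z (s :: v) = lex_lt_from s w v.
Proof.
elim: w z s v => [|a w IH] z s [|c v] // Hw Hv Hwv.
rewrite crossings_common_step //=.
have [E|ac] := eqVneq a c => [pw pv|_ _]; last first.
  rewrite -/(crossings (zmove z s) (a :: w) (zmove z s) (c :: v)).
  rewrite crossings_fork //; last exact: compatible_tail Hwv.
  by rewrite /turn_lt !addbA.
rewrite -E in Hv Hwv pw pv *.
rewrite -(IH (zmove z s)); [|exact: compatible_tail..| |]; last 2 first.
- by move: pw; rewrite /= ?eqxx.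
- by move: pv; rewrite /= ?eqxx.
rewrite -(@left_or_up_step s a) ?addbA //.
by have /andP[] := compatible_forward Hw.
Qed.

Lemma crossings_lex z a w v :
  compatible z (a :: w) (a :: w) -> compatible z v v ->
  compatible z (a :: w) v -> ~~ prefix (a :: w) v -> ~~ prefix v (a :: w) ->
  left_or_up a (+) crossings z (a :: w) z v = lex_lt (a :: w) v.
Proof.
case: v => // c v Hw Hv Hwv; rewrite /lex_lt.
have [E|ac] := eqVneq a c => [pw pv|_ _]; last by rewrite crossings_fork.
rewrite -E in Hv Hwv pw pv *; apply: crossings_lex_from => //.
  by move: pw; rewrite /= ?eqxx.
by move: pv; rewrite /= ?eqxx.
Qed.

Lemma turn_lt_total s a c : a != opposite s -> c != opposite s -> a != c ->
  turn_lt s c a = ~~ turn_lt s a c.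
Proof. by case: s a c => [[] []] [[] []] [[] []]. Qed.

Lemma turn_lt_trans s a b c : a != opposite s -> b != opposite s -> c != opposite s ->
  a != b -> b != c -> a != c -> turn_lt s a b -> turn_lt s b c -> turn_lt s a c.
Proof. by case: s a b c => [[] []] [[] []] [[] []] [[] []]. Qed.

Lemma lex_lt_from_total s w v : forward s w -> forward s v ->
  ~~ prefix w v -> ~~ prefix v w -> lex_lt_from s v w = ~~ lex_lt_from s w v.
Proof.
elim: w s v => [|a w IH] s [|c v] //= /andP[sa fw] /andP[sc fv].
rewrite (eq_sym c); have [E|ac] /= := eqVneq a c; last by rewrite turn_lt_total.
by rewrite -E in fv sc *; exact: IH.
Qed.

Lemma lex_lt_from_trans s u w v : forward s u -> forward s w -> forward s v ->
  lex_lt_from s u w -> lex_lt_from s w v -> lex_lt_from s u v.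
Proof.
elim: u s w v => [|a u IH] s [|b w] [|c v] //=.
move=> /andP[sa fu] /andP[sb fw] /andP[sc fv].
have [E|ab] := eqVneq a b; have [E'|bc] := eqVneq b c.
- by rewrite -E' -E eqxx in fw fv *; apply: IH.
- by rewrite -E in bc *; rewrite (negbTE bc).
- by rewrite -E'; rewrite (negbTE ab).
have [E|ac] := eqVneq a c; last exact: turn_lt_trans.
rewrite -E => t1; rewrite turn_lt_total ?t1 //.
Qed.

Lemma lex_lt_total z w v : compatible z w w -> compatible z v v ->
  ~~ prefix w v -> ~~ prefix v w -> lex_lt v w = ~~ lex_lt w v.
Proof.
case: w v => [|a w] [|c v] //= Hw Hv.
have fw := compatible_forward Hw; have fv := compatible_forward Hv.
rewrite (eq_sym c); have [E|ac] /= := eqVneq a c; last first.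
  by case: a c ac {Hw Hv fw fv} => [[] []] [[] []].
by rewrite -E in fv *; exact: lex_lt_from_total.
Qed.

Lemma lex_lt_trans z u w v :
  compatible z u u -> compatible z w w -> compatible z v v ->
  lex_lt u w -> lex_lt w v -> lex_lt u v.
Proof.
case: u w v => [|a u] [|b w] [|c v] //= Hu Hw Hv.
have fu := compatible_forward Hu; have fw := compatible_forward Hw.
have fv := compatible_forward Hv.
have [E|ab] := eqVneq a b; have [E'|bc] := eqVneq b c.
- by rewrite -E' -E eqxx in fw fv *; apply: lex_lt_from_trans.
- by rewrite -E in bc *; rewrite (negbTE bc).
- by rewrite -E'; rewrite (negbTE ab).
have [E|ac] := eqVneq a c.
  by rewrite -E; case: a b ab {Hu Hw Hv fu fw fv E bc} => [[] []] [[] []].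
by case: a b c ab bc ac {Hu Hw Hv fu fw fv} => [[] []] [[] []] [[] []].
Qed.

(** * Trees of shortest walks *)

Fixpoint follows (E : zpoint -> zpoint -> Prop) z (w : seq direction) : Prop :=
  if w is d :: w' then E z (zmove z d) /\ follows E (zmove z d) w' else True.

Lemma walk_end_rcons z w d : walk_end z (rcons w d) = zmove (walk_end z w) d.
Proof. by rewrite /walk_end foldl_rcons. Qed.

Lemma follows_rcons E z w d : follows E z (rcons w d) <->
  follows E z w /\ E (walk_end z w) (zmove (walk_end z w) d).
Proof. by elim: w z => [|f w IH] z /=; [tauto | rewrite IH; tauto]. Qed.

Fixpoint walk_to (par : zpoint -> zpoint * direction) n z : seq direction :=
  if n is n'.+1 then rcons (walk_to par n' (par z).1) (par z).2 else [::].

Section ShortestWalks.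
Variables (E : zpoint -> zpoint -> Prop) (z0 : zpoint).

Definition reach n z := exists w,
  [/\ size w = n, follows E z0 w & walk_end z0 w = z].

Lemma reach_step n y d : reach n y -> E y (zmove y d) -> reach n.+1 (zmove y d).
Proof.
move=> [w [sw fw wy]] Ey; exists (rcons w d).
by split; rewrite ?size_rcons ?sw ?walk_end_rcons ?wy //; apply/follows_rcons; rewrite wy.
Qed.

Let dist n z := reach n z /\ forall m, (m < n)%N -> ~ reach m z.

Let dist_ex n z : reach n z -> exists m, dist m z.
Proof.
move=> H; have ex : exists n, `[< reach n z >] by exists n; apply/asboolP.
have [m /asboolP rm mmin] := ex_minnP ex; exists m; split=> // k km /asboolP rk.
by have := mmin _ rk; rewrite leqNgt km.
Qed.

Let dist_unique m n z : dist m z -> dist n z -> m = n.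
Proof.
by move=> [rm hm] [rn hn]; case: (ltngtP m n) => // [/hn|/hm].
Qed.

Let parent_ex z : exists yd : zpoint * direction, forall n, dist n.+1 z ->
  [/\ dist n yd.1, E yd.1 z & zmove yd.1 yd.2 = z].
Proof.
have [[n [[w [sw fw wz]] hz]]|no] := pselect (exists n, dist n.+1 z); last first.
  by exists (z0, (true, true)) => n dn; case: no; exists n.
case/lastP: w sw fw wz => // w d; rewrite size_rcons walk_end_rcons.
move=> [sw] /follows_rcons[fw Ewz] wz.
exists (walk_end z0 w, d) => m dm; have [->] : m.+1 = n.+1.
  by apply: dist_unique dm _; split=> //; rewrite -wz; apply: reach_step => //; exists w.
split; rewrite /= -?wz //; split; first by exists w.
by move=> k kn rk; apply: (hz k.+1) => //; rewrite -wz; apply: reach_step.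
Qed.

(** Each reachable point other than [z0] gets one fixed predecessor, a step nearer to [z0]. Prefixes
    of the resulting walks are again such walks, so two of them agree up to any point they share. *)
Lemma shortest_walk_tree : exists tree : zpoint -> seq direction,
  forall n z, reach n z ->
  [/\ follows E z0 (tree z), walk_end z0 (tree z) = z
    & forall i, (i <= size (tree z))%N ->
      tree (walk_end z0 (take i (tree z))) = take i (tree z)].
Proof.
have [par parP] := boolp.choice parent_ex.
pose up := walk_to par.
have [ht htP] : exists ht : zpoint -> nat, forall z n, dist n z -> ht z = n.
  have [z|ht htP] := @boolp.choice zpoint nat (fun z m => forall n, dist n z -> m = n).
    have [[m dm]|no] := pselect (exists m, dist m z).
      by exists m => n dn; apply: dist_unique dm dn.
    by exists 0%N => n dn; case: no; exists n.
  by exists ht.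
have upP n z : dist n z ->
    [/\ size (up n z) = n, follows E z0 (up n z), walk_end z0 (up n z) = z
      & forall i, (i <= n)%N -> dist i (walk_end z0 (take i (up n z))) /\
          up i (walk_end z0 (take i (up n z))) = take i (up n z)].
  elim: n z => [|n IH] z dn.
    have [[w [sw _ wz]] _] := dn; rewrite (size0nil sw) /= in wz.
    by rewrite -wz in dn *; split=> //= i; rewrite leqn0 => /eqP->.
  have [dy Ey yz] := parP z n dn; have [sy fy ye pre] := IH _ dy.
  have -> : up n.+1 z = rcons (up n (par z).1) (par z).2 by [].
  split; first by rewrite size_rcons sy.
  - by apply/follows_rcons; rewrite ye yz.
  - by rewrite walk_end_rcons ye.
  move=> i; rewrite leq_eqVlt => /orP[/eqP->|ilt].
    by rewrite take_oversize ?size_rcons ?sy // walk_end_rcons ye yz.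
  by rewrite -cats1 takel_cat ?sy //; apply: pre.
exists (fun z => up (ht z) z) => n z /dist_ex[m dm].
have [sm fm me pre] := upP _ _ dm; rewrite (htP _ _ dm); split=> // i.
by rewrite sm => /pre[/htP ->].
Qed.

End ShortestWalks.

Definition joined (P : zpoint -> Prop) (x y : zpoint) := exists w,
  (forall p, on_walk x w p -> P p) /\ walk_end x w = y.

Lemma on_walk_end z w : on_walk z w (walk_end z w).
Proof. by elim: w z => [|d w IH] z /=; [left | right]. Qed.

(** * Ranks from a tree of walks *)

Section TreeOrder.
Variables (T : finType) (r : T -> seq direction) (z0 : zpoint).
Hypothesis r_compat : forall a c, compatible z0 (r a) (r c).
Hypothesis r_prefix : forall a c, a != c -> ~~ prefix (r a) (r c).

Let lt a c := lex_lt (r a) (r c).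

Definition tree_rank c := #|[pred a | lt a c]|.

Let lt_irr a : lt a a = false.
Proof.
rewrite /lt; case: (r a) => [//|d w] /=; rewrite eqxx.
by elim: w d => //= f w IH d; rewrite eqxx.
Qed.

Let lt_tr : transitive lt.
Proof. by move=> b a c; apply: (lex_lt_trans (z := z0)). Qed.

Let lt_tot a c : a != c -> lt c a = ~~ lt a c.
Proof.
by move=> ac; apply: (lex_lt_total (z := z0)) => //; apply: r_prefix; rewrite // eq_sym.
Qed.

Let lt_rank a c : lt a c -> (tree_rank a < tree_rank c)%N.
Proof.
move=> ac; apply: proper_card; apply/properP; split.
  by apply/fintype.subsetP => b; rewrite !inE => /lt_tr; apply.
by exists a; rewrite !inE ?lt_irr.
Qed.

Lemma tree_rank_inj : injective tree_rank.
Proof.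
move=> a c E; apply/eqP; apply: contraT => ac.
case: (boolP (lt a c)) => [/lt_rank|]; first by rewrite E ltnn.
by rewrite -lt_tot // => /lt_rank; rewrite E ltnn.
Qed.

(** The order is the crossing parity up to a bit depending on [a] alone, which cancels when [a] is
    compared with two vertices. *)
Lemma tree_rank_lt a c : a != c ->
  (tree_rank a < tree_rank c)%N =
  left_or_up (head (true, true) (r a)) (+) crossings z0 (r a) z0 (r c).
Proof.
move=> ac; transitivity (lt a c).
  apply/idP/idP => [|/lt_rank //]; apply: contraTT.
  by rewrite -lt_tot // => /lt_rank; rewrite -leqNgt => /ltnW.
move: (@r_compat a a) (@r_compat a c) (@r_compat c c) (r_prefix ac); rewrite eq_sym in ac.
move: (r_prefix ac); rewrite /lt; case: (r a) => [|d w] H1 H2 H3 H4 H5.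
  by rewrite prefix0s in H5.
by rewrite [RHS]crossings_lex.
Qed.

End TreeOrder.

(* [core] stands for a connected part of the face, [S a] adds to it an access to
   the vertex [a], drawn at [hat a], and [A a b] stands for the edge ab. *)
Lemma lattice_noncrossing (T : finType) (e : rel T)
  (core : zpoint -> Prop) (S : T -> zpoint -> Prop) (A : T -> T -> zpoint -> Prop)
  (hat : T -> zpoint) (z0 : zpoint) :
  core z0 ->
  (forall z, core z -> joined core z0 z) ->
  (forall a z, core z -> S a z) ->
  (forall a, joined (S a) z0 (hat a)) ->
  (forall a c z, a != c -> S a z -> S c z -> core z) ->
  (forall a c, a != c -> ~ S c (hat a)) ->
  (forall a b, e a b -> joined (A a b) (hat a) (hat b)) ->
  (forall a b c z, e a b -> c != a -> c != b -> A a b z -> S c z -> False) ->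
  (forall a b c d z, e a b -> e c d -> a != c -> a != d -> b != c -> b != d ->
     A a b z -> A c d z -> False) ->
  exists2 rk : T -> nat, injective rk & noncrossing e rk.
Proof.
move=> core0 coreC coreS hatS SS hatnS Ae AS AA.
(* Steps may leave [core] but not return to it: a walk ending at [hat a] thus
   stays in [S a]. *)
pose E u v := (core u /\ core v) \/ exists a, [/\ S a u, S a v & ~ core v].
(* Whenever the walk is in [core], a walk inside [core] replaces it up to there, which removes all
   returns from outside. *)
have reachable a w : (forall p, on_walk z0 w p -> S a p) ->
    exists n, reach E z0 n (walk_end z0 w).
  have core_reach z : core z -> exists n, reach E z0 n z.
    move=> /coreC[v [vc <-]]; exists (size v), v; split=> //.
    elim: v z0 vc {core0 coreC hatS z w} => //= d v IH x vc; split.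
      by left; split; apply: vc; [left|right; exact: on_walk_start].
    by apply: IH => p pv; apply: vc; right.
  elim/last_ind: w => [|w d IH] inS; first exact: core_reach.
  have inSw p : on_walk z0 w p -> S a p.
    by move=> pw; apply: inS; rewrite -cats1 on_walk_cat; left.
  have [n rn] := IH inSw.
  have [ce|nce] := pselect (core (walk_end z0 (rcons w d))); first exact: core_reach.
  exists n.+1; rewrite walk_end_rcons; apply: reach_step => //; right; exists a.
  rewrite -walk_end_rcons; split=> //; first by apply/inSw/on_walk_end.
  exact/inS/on_walk_end.
have [tree treeP] := shortest_walk_tree E z0.
pose r a := tree (hat a).
have hat_reach a : exists n, reach E z0 n (hat a).
  by have [w [wS <-]] := hatS a; apply: reachable wS.
have r_end a : walk_end z0 (r a) = hat a by have [n /treeP[]] := hat_reach a.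
have r_compat a c : compatible z0 (r a) (r c).
  have [n /treeP[_ _ Ha]] := hat_reach a; have [m /treeP[_ _ Hc]] := hat_reach c.
  by move=> i j /Ha E1 /Hc E2 EE; rewrite /r in EE *; rewrite -E1 -E2 EE.
have r_in a p : on_walk z0 (r a) p -> S a p.
  have [n /treeP[fa + _]] := hat_reach a; rewrite -/(r a) in fa *.
  have : S a (hat a) by have [w [wS <-]] := hatS a; apply/wS/on_walk_end.
  move=> + He; rewrite -{}He; elim/last_ind: (r a) fa => [_ Sz [->|[]]//|w d IH].
  rewrite -cats1 on_walk_cat cats1 walk_end_rcons /=.
  move=> /follows_rcons[fw Ed] Sd pw.
  (* Backwards along the walk: a step ending outside [core] lies in some [S c], and [c] is [a]
     because distinct regions share only [core] points. *)
  have Sw : S a (walk_end z0 w).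
    case: Ed => [[cu _]|[c [Su Sv ncv]]]; first exact: coreS.
    have [<- //|ca] := eqVneq c a; by case: ncv; apply: SS ca Sv Sd.
  case: pw => [|[->|[->|[]]]] //; exact: IH.
have r_prefix a c : a != c -> ~~ prefix (r a) (r c).
  move=> ac; apply/negP => /prefixP[w rc]; apply: (hatnS _ _ ac); apply: r_in.
  by rewrite rc on_walk_cat r_end; right; exact: on_walk_start.
exists (tree_rank r); first exact: (tree_rank_inj r_compat).
move=> a b c d eab ecd [ac cb bd].
have lt_neq x y : (tree_rank r x < tree_rank r y)%N -> x != y.
  by apply: contraTneq => ->; rewrite ltnn.
have nac := lt_neq _ _ ac; have ncb := lt_neq _ _ cb; have nbd := lt_neq _ _ bd.
have nad := lt_neq _ _ (ltn_trans ac (ltn_trans cb bd)).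
have nbc : b != c by rewrite eq_sym.
have [w [wA we]] := Ae _ _ eab; have [v [vA ve]] := Ae _ _ ecd.
(* The closed walks run from [z0] through [a] and [b], and through [c] and [d], back to [z0]. *)
have := @crossings_quadrangle z0 (r a ++ w) (r b) z0 (r c ++ v) (r d).
rewrite /walk_end !foldl_cat -!/(walk_end _ _) !r_end we ve => /(_ erefl erefl).
rewrite !crossings_catl !crossings_catr !r_end.
have -> : crossings (hat a) w z0 (r c) = false.
  by apply: crossings_disjoint => p /wA pA /r_in; apply: AS pA; rewrite // eq_sym.
have -> : crossings (hat a) w z0 (r d) = false.
  by apply: crossings_disjoint => p /wA pA /r_in; apply: AS pA; rewrite // eq_sym.
have -> : crossings z0 (r a) (hat c) v = false.
  by apply: crossings_disjoint => p /r_in pS /vA pA; apply: AS pA pS.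
have -> : crossings z0 (r b) (hat c) v = false.
  by apply: crossings_disjoint => p /r_in pS /vA pA; apply: AS pA pS.
have -> : crossings (hat a) w (hat c) v = false.
  by apply: crossings_disjoint => p /wA pA /vA; apply: AA pA.
(* The bits of [a] and [b] occur twice and cancel. Of the comparisons ac, ad, bc, bd all but bc
   hold, so the sum of the four parities is odd, a contradiction. *)
have := tree_rank_lt r_compat r_prefix nac; rewrite ac.
have := tree_rank_lt r_compat r_prefix nad; rewrite (ltn_trans ac (ltn_trans cb bd)).
have := tree_rank_lt r_compat r_prefix nbc; rewrite ltnNge (ltnW cb).
have := tree_rank_lt r_compat r_prefix nbd; rewrite bd /=.
move: (left_or_up _) (left_or_up _) (crossings _ _ _ (r c)) (crossings _ _ _ (r c)).
move: (crossings _ _ _ (r d)) (crossings _ _ _ (r d)).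
by do 6!case.
Qed.

(** * From plane embeddings to lattice walks *)

Section PlaneTopology.
Local Open Scope classical_set_scope.
Variable R : realType.
Implicit Types (x y : R * R) (A B C D F : set (R * R)).

(** The points of [C] satisfying [P] and those violating it are both relatively open, as unions of
    balls. *)
Lemma connected_local_constancy C (P : R * R -> Prop) (r : R * R -> R) x0 :
  connected C -> C x0 -> P x0 ->
  (forall x, C x -> 0 < r x) ->
  (forall x y, C x -> C y -> ball x (r x) y -> (P x <-> P y)) ->
  forall y, C y -> P y.
Proof.
move=> cC Cx0 Px0 r0 H y Cy.
suff E : [set x | C x /\ P x] = C by case: (eq_ind_r (fun A => A y) Cy E).
have openU (Q : set (R * R)) : open (\bigcup_(x in Q) ball x (r x)).
  by apply: bigcup_open => x _; exact: ball_open.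
apply: cC; first by exists x0.
  exists (\bigcup_(x in [set x | C x /\ P x]) ball x (r x)) => //.
  apply/seteqP; split=> [x [Cx Px]|x [Cx [z [Cz Pz] zx]]].
    by split=> //; exists x => //; apply: ballxx; exact: r0.
  by split=> //; apply/(H z x).
exists (~` \bigcup_(x in [set x | C x /\ ~ P x]) ball x (r x)).
  exact: open_closedC.
apply/seteqP; split=> [x [Cx Px]|x [Cx nx]].
  by split=> // -[z [Cz nPz] zx]; apply: nPz; apply/(H z x).
split=> //; apply: contrapT => nPx; apply: nx; exists x => //.
by apply: ballxx; exact: r0.
Qed.

Definition segment x y : set (R * R) := [set x + t *: (y - x) | t in `[0, 1]].

Lemma segment_continuous x y : continuous (fun t : R => x + t *: (y - x)).
Proof. by move=> t; apply: cvgD; [exact: cvg_cst | apply: cvgZr_tmp; exact: cvg_id]. Qed.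

Lemma segment_is_compact x y : compact (segment x y).
Proof.
apply: continuous_compact; last exact: segment_compact.
by apply: continuous_subspaceT; exact: segment_continuous.
Qed.

Lemma segment_is_connected x y : connected (segment x y).
Proof.
apply: connected_continuous_connected; first exact: segment_connected.
by apply: continuous_subspaceT; exact: segment_continuous.
Qed.

Lemma segment_left x y : segment x y x.
Proof. by exists 0; rewrite /= ?in_itv /= ?lexx ?ler01 // scale0r addr0. Qed.

Lemma segment_right x y : segment x y y.
Proof. by exists 1; rewrite /= ?in_itv /= ?lexx ?ler01 // scale1r addrC subrK. Qed.

Lemma segment_ball x y r z : ball x r y -> segment x y z -> ball x r z.
Proof.
move=> xy [t /=]; rewrite in_itv /= => /andP[t0 t1] <-; move: xy.
rewrite -!ball_normE /= opprD addrA subrr add0r normrN normrZ (ger0_norm t0).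
by apply: le_lt_trans; rewrite distrC ler_piMl.
Qed.

(** Being joined to [x] by such a set is locally constant on [F]: nearby points are linked by a
    segment in a ball missing [D]. *)
Lemma compact_connected_join D F x y : closed D -> connected F -> F `<=` ~` D ->
  F x -> F y -> exists K, [/\ compact K, connected K, K `<=` ~` D, K x & K y].
Proof.
move=> cD cF FD Fx Fy.
have rad z : exists r : R, F z -> 0 < r /\ ball z r `<=` ~` D.
  have [Fz|] := pselect (F z); last by exists 0.
  have : nbhs z (~` D) by apply: open_nbhs_nbhs; split; [exact: closed_openC|exact: FD].
  by move=> /nbhs_ballP[r /= r0 rD]; exists r.
have [r rP] := boolp.choice rad.
pose P z := exists K, [/\ compact K, connected K, K `<=` ~` D, K x & K z].
apply: (@connected_local_constancy F P r x) => //.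
- exists [set x]; split=> //; [exact: compact_set1|exact: connected1|].
  by move=> z ->; exact: FD.
- by move=> z /rP[].
move=> a b Fa Fb ab; have [_ aD] := rP _ Fa.
have ext K c : K c -> segment a b c -> compact K -> connected K -> K `<=` ~` D ->
    K x -> P a /\ P b.
  move=> Kc sc cK coK KD Kx.
  have Q z : segment a b z -> P z.
    move=> sz; exists (K `|` segment a b); split.
    - by apply: compactU => //; exact: segment_is_compact.
    - apply: connectedU => //; first by exists c.
      exact: segment_is_connected.
    - by move=> w [/KD //|/(segment_ball ab)/aD].
    - by left.
    - by right.
  by split; apply: Q; [exact: segment_left|exact: segment_right].
split=> -[K [cK coK KD Kx Kz]].
  by have [] := ext K a Kz (segment_left a b) cK coK KD Kx.
by have [] := ext K b Kz (segment_right a b) cK coK KD Kx.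
Qed.

(** The distances between [A] and [B] form a compact set missing 0. *)
Lemma compact_separated A B : compact A -> compact B -> A `&` B = set0 ->
  exists2 r : R, 0 < r & forall x y, A x -> B y -> r <= `|x - y|.
Proof.
move=> cA cB AB; pose f (p : (R * R) * (R * R)) := `|p.1 - p.2|.
have cf : continuous f.
  by move=> p; apply: cvg_norm; apply: cvgB; [exact: cvg_fst|exact: cvg_snd].
have /compact_closed cl : compact (f @` (A `*` B)).
  apply: continuous_compact; last exact: compact_setX.
  exact: continuous_subspaceT.
have : nbhs (0 : R) (~` (f @` (A `*` B))).
  apply: open_nbhs_nbhs; split; first by apply/closed_openC/cl/Rhausdorff.
  move=> [[x y] [/= Ax By]] /eqP; rewrite normr_eq0 subr_eq0 => /eqP /= xy.
  by have : (A `&` B) x; [split; rewrite // xy | rewrite AB].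
move=> /nbhs_ballP[r /= r0 rP]; exists r => // x y Ax By.
rewrite leNgt; apply/negP => lt; apply: (rP `|x - y|).
  by rewrite -ball_normE /= sub0r normrN normr_id.
by exists (x, y).
Qed.

Lemma compact_family_separated (I : finType) (K : I -> set (R * R)) :
  (forall i, compact (K i)) ->
  exists2 r : R, 0 < r & forall i j x y, K i `&` K j = set0 ->
    K i x -> K j y -> r <= `|x - y|.
Proof.
move=> cK.
have ex (ij : I * I) : exists r : R, 0 < r /\ (K ij.1 `&` K ij.2 = set0 ->
    forall x y, K ij.1 x -> K ij.2 y -> r <= `|x - y|).
  have [d|nd] := pselect (K ij.1 `&` K ij.2 = set0); last by exists 1.
  by have [r r0 rP] := compact_separated (cK _) (cK _) d; exists r.
have [r rP] := boolp.choice ex.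
exists (\big[Num.min/1]_ij r ij).
  by elim/big_ind: _ => // [a b a0 b0|ij _]; [rewrite lt_min a0|have [] := rP ij].
move=> i j x y d Kx Ky; apply: le_trans (proj2 (rP (i, j)) d _ _ Kx Ky).
exact: bigmin_le_cond.
Qed.

End PlaneTopology.

(** * Joining lattice points *)

Section Joined.
Variable P : zpoint -> Prop.

Lemma joined_refl z : P z -> joined P z z.
Proof. by move=> Pz; exists [::]; split=> // p [->|[]]. Qed.

Lemma joined_trans y x z : joined P x y -> joined P y z -> joined P x z.
Proof.
move=> [w [wP wy]] [v [vP vz]]; exists (w ++ v); split.
  by move=> p /on_walk_cat[/wP //|]; rewrite wy => /vP.
by rewrite /walk_end foldl_cat -/(walk_end x w) wy.
Qed.

Lemma joined_step z d : P z -> P (zmove z d) -> joined P z (zmove z d).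
Proof. by move=> Pz Pd; exists [:: d]; split=> // p [->//|[->//|[]]]. Qed.

Lemma joined_sym x y : joined P x y -> joined P y x.
Proof.
move=> [w [wP <-]]; elim: w x wP => [|d w IH] x wP /=.
  by apply: joined_refl; apply: wP; left.
apply: (joined_trans (y := zmove x d)); first by apply: IH => p pw; apply: wP; right.
rewrite -{2}(zmove_opp x d); apply: joined_step; rewrite ?zmove_opp; apply: wP.
  by right; exact: on_walk_start.
by left.
Qed.

Lemma joined_row (a b : int) (n : nat) :
  (forall k : nat, (k <= n)%N -> P (a + k%:Z, b)) -> joined P (a, b) (a + n%:Z, b).
Proof.
elim: n => [|n IH] H; first by rewrite addr0; apply: joined_refl; have := H 0%N; rewrite addr0; apply.
apply: (joined_trans (y := (a + n%:Z, b))).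
  by apply: IH => k kn; apply: H; exact: leqW.
have E : zmove (a + n%:Z, b) (false, true) = (a + n.+1%:Z, b).
  by rewrite /zmove /sgn /=; congr pair; lia.
by rewrite -E; apply: joined_step; rewrite ?E; apply: H.
Qed.

Lemma joined_col (a b : int) (n : nat) :
  (forall k : nat, (k <= n)%N -> P (a, b + k%:Z)) -> joined P (a, b) (a, b + n%:Z).
Proof.
elim: n => [|n IH] H; first by rewrite addr0; apply: joined_refl; have := H 0%N; rewrite addr0; apply.
apply: (joined_trans (y := (a, b + n%:Z))).
  by apply: IH => k kn; apply: H; exact: leqW.
have E : zmove (a, b + n%:Z) (true, true) = (a, b + n.+1%:Z).
  by rewrite /zmove /sgn /=; congr pair; lia.
by rewrite -E; apply: joined_step; rewrite ?E; apply: H.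
Qed.

Lemma joined_box (z z' : zpoint) :
  (forall i j : int, Num.min z.1 z'.1 <= i <= Num.max z.1 z'.1 ->
     Num.min z.2 z'.2 <= j <= Num.max z.2 z'.2 -> P (i, j)) ->
  joined P z z'.
Proof.
case: z z' => [a b] [a' b'] /= H; apply: (joined_trans (y := (a', b))).
  have [le|/ltW le] := leP a a'.
    have := @joined_row a b `|a' - a|%N; rewrite (_ : a + _ = a'); last by lia.
    by apply=> k kn; apply: H; lia.
  have := @joined_row a' b `|a' - a|%N; rewrite (_ : a' + _ = a); last by lia.
  by move=> J; apply/joined_sym/J => k kn; apply: H; lia.
have [le|/ltW le] := leP b b'.
  have := @joined_col a' b `|b' - b|%N; rewrite (_ : b + _ = b'); last by lia.
  by apply=> k kn; apply: H; lia.
have := @joined_col a' b' `|b' - b|%N; rewrite (_ : b' + _ = b); last by lia.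
by move=> J; apply/joined_sym/J => k kn; apply: H; lia.
Qed.

End Joined.

Lemma joined_sub (P Q : zpoint -> Prop) x y :
  (forall z, P z -> Q z) -> joined P x y -> joined Q x y.
Proof. by move=> PQ [w [wP wy]]; exists w; split=> // p /wP/PQ. Qed.

(** * Lattice approximation of plane sets *)

Section Lattice.
Local Open Scope classical_set_scope.
Variables (R : realType) (eps : R).
Hypothesis eps_gt0 : 0 < eps.

(** The tolerance is twice the rounding error [eps / 2], so that points within [eps / 2] of each
    other share a lattice point. *)
Definition grid_near (x : R * R) (z : zpoint) : Prop :=
  `|x.1 - eps * z.1%:~R| <= eps /\ `|x.2 - eps * z.2%:~R| <= eps.

Definition lattice (C : set (R * R)) (z : zpoint) : Prop :=
  exists2 x, C x & grid_near x z.

Let between (t : R) (a b k : int) :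
  `|t - eps * a%:~R| <= eps -> `|t - eps * b%:~R| <= eps ->
  Num.min a b <= k <= Num.max a b -> `|t - eps * k%:~R| <= eps.
Proof.
rewrite !ler_norml => /andP[a1 a2] /andP[b1 b2].
have mono (i j : int) : i <= j -> eps * i%:~R <= eps * j%:~R.
  by move=> ij; rewrite ler_pM2l // ler_int.
have [ab|/ltW ab] := leP a b => /andP[/mono h1 /mono h2]; apply/andP; split; lra.
Qed.

Lemma grid_near_joined x z z' : grid_near x z -> grid_near x z' ->
  joined (grid_near x) z z'.
Proof.
move=> [h1 h2] [h1' h2']; apply: joined_box => i j ci cj.
by split=> /=; [exact: between ci | exact: between cj].
Qed.

Definition grid_round (x : R * R) : zpoint :=
  (Num.floor (x.1 / eps + 2^-1), Num.floor (x.2 / eps + 2^-1)).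

Let round_coord (t : R) : `|t - eps * (Num.floor (t / eps + 2^-1))%:~R| <= eps / 2.
Proof.
have /andP[] := floor_itv (t / eps + 2^-1).
set m := (Num.floor _)%:~R.
rewrite -(ler_pM2l eps_gt0) -(ltr_pM2l eps_gt0) !mulrDr intrD mulrDr.
rewrite mulrCA divff ?gt_eqF // !mulr1 => h1 h2.
by rewrite ler_norml; apply/andP; split; lra.
Qed.

Lemma grid_near_round x y : `|x - y| <= eps / 2 -> grid_near y (grid_round x).
Proof.
rewrite prod_normE ge_max => /andP[/= h1 h2].
split; [move: h1; have := round_coord x.1 | move: h2; have := round_coord x.2];
  rewrite /grid_round /=; set m := eps * _; rewrite !ler_norml => /andP[a1 a2] /andP[b1 b2];
  apply/andP; split; lra.
Qed.

(** Since nearby points of [C] share a rounded lattice point, being joined to [z] is locally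
    constant along [C]. *)
Lemma lattice_joined C x y z z' : connected C -> C x -> C y ->
  grid_near x z -> grid_near y z' -> joined (lattice C) z z'.
Proof.
move=> cC Cx Cy xz yz'.
have sub u a b : C u -> grid_near u a -> grid_near u b -> joined (lattice C) a b.
  move=> Cu ua ub; apply: joined_sub (grid_near_joined ua ub) => p up; by exists u.
suff : forall u, C u -> exists2 a, grid_near u a & joined (lattice C) z a.
  by move=> /(_ _ Cy)[a ya za]; apply: joined_trans za _; apply: sub Cy ya yz'.
apply: (@connected_local_constancy R C _ (fun=> eps / 2) x) => //.
- by exists z => //; exact: (sub x).
- by move=> ? _; rewrite divr_gt0.
move=> u v Cu Cv; rewrite -ball_normE /= => /ltW uv.
have ur : grid_near u (grid_round u) by apply: grid_near_round; rewrite subrr normr0 divr_ge0 // ltW.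
have vr : grid_near v (grid_round u) by exact: grid_near_round.
split=> -[a ua za]; exists (grid_round u) => //; apply: joined_trans za _.
  exact: sub Cu ua ur.
exact: sub Cv ua vr.
Qed.

Lemma lattice_meet C C' z : lattice C z -> lattice C' z ->
  exists x y, [/\ C x, C' y & `|x - y| <= 2 * eps].
Proof.
move=> [x Cx [x1 x2]] [y Cy [y1 y2]]; exists x, y; split=> //.
rewrite prod_normE ge_max; apply/andP; split=> /=.
  by move: x1 y1; rewrite !ler_norml => /andP[a1 a2] /andP[b1 b2]; apply/andP; split; lra.
by move: x2 y2; rewrite !ler_norml => /andP[a1 a2] /andP[b1 b2]; apply/andP; split; lra.
Qed.

End Lattice.

(** * Noncrossing order from an outerplanar embedding *)

Section OuterplanarOrder.
Local Open Scope classical_set_scope.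

Lemma bigsetUE (X : Type) (I : finType) (F : I -> set X) x :
  (\big[setU/set0]_i F i) x <-> exists i, F i x.
Proof.
rewrite -bigcup_seq; split=> [[i _ Fi]|[i Fi]]; exists i => //=.
by rewrite mem_index_enum.
Qed.

Variables (R : realType) (T : finType) (e : rel T).

Lemma is_arc_compact (A : set (R * R)) x y : is_arc A x y -> compact A.
Proof.
by move=> [g [cg _ _ _ ->]]; apply: continuous_compact => //; exact: segment_compact.
Qed.

Lemma is_arc_connected (A : set (R * R)) x y : is_arc A x y -> connected A.
Proof.
by move=> [g [cg _ _ _ ->]]; apply: connected_continuous_connected => //; exact: segment_connected.
Qed.

Lemma is_arc_ends (A : set (R * R)) x y : is_arc A x y -> A x /\ A y.
Proof.
move=> [g [_ _ <- <- ->]].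
by split; [exists 0 | exists 1]; rewrite //= in_itv /= lexx ler01.
Qed.

Variables (pos : T -> R * R) (arc : {set T} -> set (R * R)).
Hypothesis emb : plane_embedding e pos arc.

(** Non-edges get the empty set, which makes the family compact for all pairs. *)
Let arc_of (uv : T * T) : set (R * R) :=
  if e uv.1 uv.2 then arc [set uv.1; uv.2]%SET else set0.

Let arc_of_compact uv : compact (arc_of uv).
Proof.
rewrite /arc_of; case: ifP => [/(arc_ends emb)/is_arc_compact //|_].
exact: compact0.
Qed.

Lemma drawing_compact : compact (drawing e pos arc).
Proof.
have -> : drawing e pos arc =
    \big[setU/set0]_u [set pos u] `|` \big[setU/set0]_uv arc_of uv.
  apply/seteqP; split=> z [].
  - by move=> [u _ <-]; left; apply/bigsetUE; exists u.
  - by move=> [u [v [uv zuv]]]; right; apply/bigsetUE; exists (u, v); rewrite /arc_of /= uv.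
  - by move=> /bigsetUE[u ->]; left; exists u.
  - move=> /bigsetUE[[u v]]; rewrite /arc_of /=; case: ifP => // uv zuv.
    by right; exists u, v.
apply: compactU; apply: bigsetU_compact => // u _; exact: compact_set1.
Qed.

Lemma embedding_separation : exists2 del : R, 0 < del &
  (forall a c, a != c -> del <= `|pos a - pos c|) /\
  (forall a u v x, e u v -> a != u -> a != v -> arc [set u; v]%SET x ->
     del <= `|pos a - x|).
Proof.
pose K (i : T + T * T) := match i with inl a => [set pos a] | inr uv => arc_of uv end.
have [|del del0 delP] := @compact_family_separated R _ K.
  by move=> [a|uv] /=; [exact: compact_set1 | exact: arc_of_compact].
exists del => //; split=> [a c ac|a u v x uv au av xuv].
  apply: (delP (inl a) (inl c)) => //=; apply/seteqP; split=> // z [/= ->].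
  by move/(pos_inj emb) => E; rewrite E eqxx in ac.
apply: (delP (inl a) (inr (u, v))) => //=; last by rewrite /arc_of /= uv.
apply/seteqP; split=> // z [/= ->]; rewrite /arc_of /= uv.
by move/(arc_avoids_vertices emb uv) => [] E; rewrite E eqxx in au av.
Qed.

Variable F : set (R * R).
Hypothesis F_face : is_face (drawing e pos arc) F.
Hypothesis F_boundary : forall v, boundary F (pos v).

Lemma face_noncrossing : exists2 rk : T -> nat, injective rk & noncrossing e rk.
Proof.
have [[t0 _]|noT] := pselect (exists t : T, True); last first.
  by exists (fun=> 0%N) => [a|a]; case: noT; exists a.
pose D := drawing e pos arc.
have clD : closed D by apply: compact_closed drawing_compact; exact: norm_hausdorff.
have [z Dz FE] := F_face.
have Fz : F z by rewrite FE; exact: connected_component_refl.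
have FD : F `<=` ~` D by rewrite FE; exact: connected_component_sub.
have Fcon : connected F by rewrite FE; exact: component_connected.
have [del del0 [del_pos del_arc]] := embedding_separation.
have half x : del <= x -> x < del / 2 -> False by move: del0; lra.
(* The boundary condition only gives points of [F] near [pos a]; the gap is bridged by the straight
   [tail]. Radius [del / 2] keeps tails apart from each other and from arcs not ending at their
   vertex. *)
have exp a : exists x, F x /\ ball (pos a) (del / 2) x.
  have [cl _] := F_boundary a.
  have /cl[x [Fx bx]] : nbhs (pos a) (ball (pos a) (del / 2)).
    by apply: nbhsx_ballx; rewrite divr_gt0.
  by exists x.
have [p pP] := boolp.choice exp.
have exK a : exists K, [/\ compact K, connected K, K `<=` ~` D, K z & K (p a)].
  by apply: compact_connected_join clD Fcon FD Fz _; case: (pP a).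
have [K KP] := boolp.choice exK.
(* A compact connected part of the face through [z] and all [p a]; the face itself has no positive
   distance to the drawing. *)
pose core := \big[setU/set0]_a K a.
pose tail a := segment (pos a) (p a).
have core_z : core z by apply/bigsetUE; exists t0; case: (KP t0).
have core_p a : core (p a) by apply/bigsetUE; exists a; case: (KP a).
have core_D : core `<=` ~` D by move=> x /bigsetUE[a]; case: (KP a) => _ _ KD _ _ /KD.
have core_compact : compact core.
  by apply: bigsetU_compact => a _; case: (KP a).
have core_connected : connected core.
  have -> : core = \bigcup_a K a.
    apply/seteqP; split=> x; first by move=> /bigsetUE[a Ka]; exists a.
    by move=> [a _ Ka]; apply/bigsetUE; exists a.
  apply: bigcup_connected => [|a _]; last by case: (KP a).
  by exists z => a _; case: (KP a).
have tail_ball a x : tail a x -> ball (pos a) (del / 2) x.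
  by apply: segment_ball; case: (pP a).
have pos_D a : D (pos a) by left; exists a.
have arc_D u v x : e u v -> arc [set u; v]%SET x -> D x by move=> uv xuv; right; exists u, v.
pose C (i : unit + T + T + T * T) := match i with
  | inl (inl (inl _)) => core | inl (inl (inr a)) => [set pos a]
  | inl (inr a) => tail a | inr uv => arc_of uv end.
have [|r r0 rP] := @compact_family_separated R _ C.
  move=> [[[_|a]|a]|uv] /=; [exact: core_compact | exact: compact_set1 | | exact: arc_of_compact].
  exact: segment_is_compact.
(* A lattice point shared by two sets puts them within [2 * eps], which is below [r]. *)
pose eps := r / 3; have eps0 : 0 < eps by rewrite divr_gt0.
have sep i j q : C i `&` C j = set0 -> lattice eps (C i) q -> lattice eps (C j) q -> False.
  move=> dij li lj; have [x [y [xi yj xy]]] := lattice_meet li lj.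
  by have := rP _ _ _ _ dij xi yj; move: xy r0; rewrite /eps; lra.
have adj x : grid_near eps x (grid_round eps x).
  by apply: grid_near_round; rewrite ?subrr ?normr0 // divr_ge0 // ltW.
have lat (B : set (R * R)) x : B x -> lattice eps B (grid_round eps x) by move=> Bx; exists x.
have latU (B B' : set (R * R)) q : lattice eps (B `|` B') q -> lattice eps B q \/ lattice eps B' q.
  by move=> [x [Bx|Bx] xq]; [left|right]; exists x.
have close (x y w : R * R) : ball x (del / 2) w -> ball y (del / 2) w -> `|x - y| < del.
  rewrite -!ball_normE /= => xw yw; rewrite (splitr del).
  by apply: le_lt_trans (ltrD xw yw); rewrite (distrC y); exact: ler_distD.
apply: (@lattice_noncrossing T e (lattice eps core) (fun a => lattice eps (core `|` tail a))
  (fun a b => lattice eps (arc_of (a, b))) (fun a => grid_round eps (pos a)) (grid_round eps z)).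
- exact: lat.
- by move=> q [x cx xq]; apply: (lattice_joined eps0 core_connected core_z cx).
- by move=> a q [x cx xq]; exists x => //; left.
- move=> a; apply: (@lattice_joined _ _ eps0 _ z (pos a)) => //; [|by left|].
    apply: connectedU => //; last exact: segment_is_connected.
    by exists (p a); split=> //; exact: segment_right.
  by right; exact: segment_left.
- move=> a c q ac /latU[//|ta] /latU[//|tc]; exfalso.
  apply: (sep (inl (inr a)) (inl (inr c)) q) => //=; apply/seteqP; split=> // x [].
  move=> /tail_ball xa /tail_ball xc; have := close _ _ _ xa xc.
  by rewrite ltNge del_pos.
- move=> a c ac /latU[l|l].
    apply: (sep (inl (inl (inl tt))) (inl (inl (inr a))) _ _ l); last exact: lat.
    by apply/seteqP; split=> // x [/core_D nD /= E]; apply: nD; rewrite E.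
  apply: (sep (inl (inr c)) (inl (inl (inr a))) _ _ l); last exact: lat.
  apply/seteqP; split=> // x [/tail_ball xc /= E]; move: xc; rewrite E -ball_normE /=.
  by have := del_pos _ _ ac; rewrite distrC; exact: half.
- move=> a b ab; have arcab := arc_ends emb ab; have [aa ab'] := is_arc_ends arcab.
  apply: (@lattice_joined _ _ eps0 _ (pos a) (pos b)) => //; rewrite /arc_of /= ab //.
  exact: is_arc_connected arcab.
- move=> a b c q ab ca cb lA /latU[l|l].
    apply: (sep (inl (inl (inl tt))) (inr (a, b)) _ _ l lA); apply/seteqP; split=> // x [].
    by rewrite /C /arc_of /= ab => /core_D nD /(arc_D _ _ _ ab).
  apply: (sep (inl (inr c)) (inr (a, b)) _ _ l lA); apply/seteqP; split=> // x [].
  rewrite /C /arc_of /= ab => /tail_ball + xab; have := del_arc _ _ _ _ ab ca cb xab.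
  by rewrite -ball_normE /=; exact: half.
move=> a b c d q ab cd ac ad bc bd; apply: (sep (inr (a, b)) (inr (c, d))).
apply/seteqP; split=> // x; rewrite /C /arc_of /= ab cd => -[xab xcd].
(* Arcs of disjoint edges could only meet at a vertex, which would be an end of both. *)
have /(arcs_meet_at_vertices emb ab cd)/(_ x) : [set a; b]%SET != [set c; d]%SET.
  apply/negP => /eqP/finset.setP/(_ a); rewrite !inE eqxx.
  by rewrite (negbTE ac) (negbTE ad).
move=> [//|w _ E]; rewrite -E in xab xcd.
have := arc_avoids_vertices emb ab xab; have := arc_avoids_vertices emb cd xcd.
by move=> [->|->] [] E'; move: ac ad bc bd; rewrite E' eqxx.
Qed.

End OuterplanarOrder.

Lemma outerplanar_noncrossing (R : realType) (T : finType) (e : rel T) :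
  outerplanar R e -> exists2 rk : T -> nat, injective rk & noncrossing e rk.
Proof.
by move=> [pos [arc [emb [F [Fface _ Fb]]]]]; exact: (face_noncrossing emb Fface Fb).
Qed.

(** * Drawings on the parabola *)

Section Parabola.
Local Open Scope classical_set_scope.
Variable R : realType.
Implicit Types (a b c d t : R) (z : R * R).

(* The chord of the parabola y = x^2 between abscissas [a] and [b]. *)
Definition chord a b : set (R * R) :=
  [set z | (z.1 - a) * (z.1 - b) <= 0 /\ z.2 = (a + b) * z.1 - a * b].

Lemma chordC a b : chord a b = chord b a.
Proof.
by apply/seteqP; split=> z [/= h1 h2]; split; rewrite ?h2 1?mulrC //; ring.
Qed.

Lemma chord_range a b t : a < b -> (t - a) * (t - b) <= 0 -> a <= t <= b.
Proof.
move=> ab h; rewrite !leNgt; apply/andP; split; apply/negP => lt.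
  suff : 0 < (t - a) * (t - b) by rewrite ltNge h.
  by rewrite nmulr_rgt0 subr_lt0 // (lt_trans lt).
suff : 0 < (t - a) * (t - b) by rewrite ltNge h.
by rewrite mulr_gt0 // subr_gt0 // (lt_trans ab).
Qed.

Lemma chord_above a b z : chord a b z -> z.1 ^+ 2 <= z.2.
Proof. move=> [h ->]; move: h; nra. Qed.

Lemma chord_parabola a b t : chord a b (t, t ^+ 2) -> t = a \/ t = b.
Proof.
move=> [_ /= h]; have /eqP : (t - a) * (t - b) = 0.
  have -> : (t - a) * (t - b) = t ^+ 2 - ((a + b) * t - a * b) by ring.
  by rewrite -h subrr.
by rewrite mulf_eq0 !subr_eq0 => /orP[] /eqP; [left|right].
Qed.

Lemma chord_is_arc a b : a != b -> is_arc (chord a b) (a, a ^+ 2) (b, b ^+ 2).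
Proof.
move=> ab; have ba0 : b - a != 0 by rewrite subr_eq0 eq_sym.
pose x := (a, a ^+ 2); pose y := (b, b ^+ 2).
exists (fun t => x + t *: (y - x)); split.
- by apply: continuous_subspaceT; exact: segment_continuous.
- move=> s t _ _ /(congr1 fst) /= /addrI; rewrite -![_ *: _]/(_ * _).
  by move/(mulIf ba0).
- by rewrite scale0r addr0.
- by rewrite scale1r addrC subrK.
apply/seteqP; split=> [[z1 z2] [/= h ->]|z [t /=]].
  exists ((z1 - a) / (b - a)).
    rewrite /= in_itv /=; apply: chord_range; first exact: ltr01.
    have -> : ((z1 - a) / (b - a) - 0) * ((z1 - a) / (b - a) - 1) =
      (z1 - a) * (z1 - b) / (b - a) ^+ 2 by field.
    by rewrite mulr_le0_ge0 // invr_ge0 sqr_ge0.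
  by congr pair; rewrite /= -[_ *: _]/(_ * _); field.
rewrite in_itv /= => /andP[t0 t1] <-; split; rewrite /= -![_ *: _]/(_ * _).
  have -> : (a + t * (b - a) - a) * (a + t * (b - a) - b) =
    - (t * (1 - t) * (b - a) ^+ 2) by ring.
  rewrite oppr_le0; apply: mulr_ge0; last exact: sqr_ge0.
  by apply: mulr_ge0; rewrite ?subr_ge0.
ring.
Qed.

(** Over the open inner interval the outer chord is strictly higher, by (c - a)(b - x) + (x - c)(b -
    d). *)
Lemma chord_nested a b c d z : a <= c -> d <= b -> (a < c) || (d < b) ->
  chord a b z -> chord c d z -> c < d -> z.2 = z.1 ^+ 2.
Proof.
case: z => x y ac db neq [/= h1 E1] [/= h2 E2] cd.
have /andP[] := chord_range cd h2.
rewrite [c <= x]le_eqVlt => /orP[/eqP Ex _|cx]; first by rewrite E2 -Ex; ring.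
rewrite le_eqVlt => /orP[/eqP Ex|xd]; first by rewrite E2 Ex; ring.
suff : 0 < (c - a) * (b - x) + (x - c) * (b - d).
  have -> : (c - a) * (b - x) + (x - c) * (b - d) =
    ((a + b) * x - a * b) - ((c + d) * x - c * d) by ring.
  by rewrite -E1 -E2 subrr ltxx.
have xb : 0 < b - x by rewrite subr_gt0 (lt_le_trans xd).
case/orP: neq => h; rewrite -subr_gt0 in h.
  by rewrite ltr_wpDr ?mulr_ge0 ?mulr_gt0 ?subr_ge0 // ltW.
apply: ltr_wpDl; last by rewrite mulr_gt0 // subr_gt0.
by apply: mulr_ge0; [rewrite subr_ge0 | exact: ltW].
Qed.

Definition below_parabola : set (R * R) := [set z | z.2 < z.1 ^+ 2].

(** A comb: every vertical ray below the parabola meets the line of height -1. *)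
Lemma below_parabola_connected : connected below_parabola.
Proof.
pose H : set (R * R) := [set (t, -1) | t in [set: R]].
pose V (x : R) : set (R * R) := [set (x, t) | t in `]-oo, x ^+ 2[%classic].
have HV x : (H `&` V x) (x, -1).
  split; first by exists x.
  exists (-1) => //=; rewrite in_itv /=; have := sqr_ge0 x; lra.
have -> : below_parabola = \bigcup_(x in [set: R]) (H `|` V x).
  apply/seteqP; split=> [[x y] /= h|[x y] [x' _ [[t _ [<- <-]]|[t /= h [<- <-]]]]].
  - by exists x => //; right; exists y => //=; rewrite in_itv.
  - by rewrite /below_parabola /=; have := sqr_ge0 t; lra.
  - by rewrite in_itv /= in h.
apply: bigcup_connected; first by exists (0, -1) => x _; left; exists 0.
move=> x _; apply: connectedU; first by exists (x, -1).
  apply: connected_continuous_connected.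
    exact/connected_intervalP.
  apply: continuous_subspaceT => t.
  by apply: (@cvg_pair _ _ _ _ (nbhs t) (nbhs (-1 : R))); [exact: cvg_id|exact: cvg_cst].
apply: connected_continuous_connected.
  by apply/connected_intervalP; exact: interval_is_interval.
apply: continuous_subspaceT => t.
by apply: (@cvg_pair _ _ _ _ (nbhs x) (nbhs t)); [exact: cvg_cst|exact: cvg_id].
Qed.

End Parabola.

(** * Noncrossing orders are outerplanar *)

Section ConvexDrawing.
Local Open Scope classical_set_scope.
Variables (R : realType) (T : finType) (e : rel T) (rk : T -> nat).
Hypotheses (e_sym : symmetric e) (e_irr : irreflexive e).
Hypotheses (rk_inj : injective rk) (ncr : noncrossing e rk).

Let x (v : T) : R := (rk v)%:R.
Let pos (v : T) : R * R := (x v, x v ^+ 2).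
Let arc (S : {set T}) : set (R * R) :=
  [set z | exists u v, S = [set u; v]%SET /\ chord (x u) (x v) z].

Let x_inj u v : x u = x v -> u = v.
Proof. by move/eqP; rewrite eqr_nat => /eqP/rk_inj. Qed.

Let arcE u v : arc [set u; v]%SET = chord (x u) (x v).
Proof.
apply/seteqP; split=> z; last by exists u, v.
move=> [u' [v' [E]]]; move/finset.setP: E => E.
have := E u; have := E v; have := E u'; have := E v'.
rewrite !inE !eqxx ?orbT /=.
move=> /orP[] /eqP-> /orP[] /eqP->; rewrite ?eqxx ?orbb ?orbT //.
- by move=> /esym/eqP -> _.
- by rewrite chordC.
- by move=> _ /esym/eqP ->.
Qed.

(* Two chords meeting off the parabola would be nested by noncrossingness. *)
Let chords_meet u v s t z : e u v -> e s t -> (rk u < rk v)%N -> (rk s < rk t)%N ->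
  (rk u <= rk s)%N -> (u, v) <> (s, t) ->
  chord (x u) (x v) z -> chord (x s) (x t) z -> z.2 = z.1 ^+ 2.
Proof.
move=> uv st ruv rst us neq zuv zst.
have [vs|sv] := leqP (rk v) (rk s).
  have [/andP[_ h1] /andP[h2 _]] : x u <= z.1 <= x v /\ x s <= z.1 <= x t.
    by split; apply: chord_range; rewrite ?ltr_nat //; [case: zuv|case: zst].
  have E : z.1 = x v.
    apply/eqP; rewrite eq_le h1 (le_trans _ h2) // ler_nat //.
  by rewrite (proj2 zuv) E; ring.
have [vt|tv] := ltnP (rk v) (rk t).
  move: us; rewrite leq_eqVlt => /orP[/eqP us|us]; last by case: (ncr uv st).
  apply: (@chord_nested R (x s) (x t) (x u) (x v)) => //; rewrite ?ler_nat ?ltr_nat ?us ?leqnn //.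
  - exact: ltnW.
  - by rewrite vt orbT.
apply: (@chord_nested R (x u) (x v) (x s) (x t)) => //; rewrite ?ler_nat ?ltr_nat //.
rewrite ltn_neqAle us andbT (ltn_neqAle (rk t)) tv andbT -negb_and.
by apply/negP => /andP[/eqP/rk_inj E /eqP/rk_inj E']; apply: neq; rewrite E E'.
Qed.

Let oriented u v : e u v -> exists u' v',
  [/\ e u' v', (rk u' < rk v')%N, [set u; v]%SET = [set u'; v']%SET
    & chord (x u) (x v) = chord (x u') (x v')].
Proof.
move=> uv; case: (ltngtP (rk u) (rk v)) => [lt|lt|/rk_inj E].
- by exists u, v.
- by exists v, u; rewrite e_sym finset.setUC chordC.
- by rewrite E e_irr in uv.
Qed.

Let embedding : plane_embedding e pos arc.
Proof.
split.
- by move=> u v [/x_inj].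
- move=> u v uv; rewrite arcE; apply: chord_is_arc.
  by apply: contraTneq uv => /x_inj ->; rewrite e_irr.
- by move=> u v w uv; rewrite arcE => /chord_parabola[] /x_inj; [left|right].
move=> u v s t uv st; rewrite !arcE => neq z [zuv zst].
suff E : z.2 = z.1 ^+ 2.
  move: zuv; rewrite [z]surjective_pairing E => /chord_parabola[] ->; last by exists v.
  by exists u.
move: neq zuv zst; have [u' [v' [uv' lt -> ->]]] := oriented uv.
have [s' [t' [st' lt' -> ->]]] := oriented st => neq zuv zst.
have neq' : (u', v') <> (s', t') by move=> [E1 E2]; rewrite E1 E2 eqxx in neq.
have [us|/ltnW su] := leqP (rk u') (rk s').
  exact: chords_meet us neq' zuv zst.
by apply: chords_meet su _ zst zuv => // E; apply: neq'; rewrite E.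
Qed.

Let drawing_above z : drawing e pos arc z -> z.1 ^+ 2 <= z.2.
Proof.
move=> [[u _ <-]//|[u [v [_]]]]; rewrite arcE; exact: chord_above.
Qed.

(** No chord dips under the parabola, so the region below it lies in one face, which is unbounded
    and adheres to every vertex. *)
Lemma noncrossing_outerplanar : outerplanar R e.
Proof.
exists pos, arc; split; first exact: embedding.
set D := drawing e pos arc.
have belowD : @below_parabola R `<=` ~` D.
  by move=> z /= zb /drawing_above; rewrite leNgt zb.
pose z0 : R * R := (0, -1).
have z0b : (@below_parabola R) z0 by rewrite /below_parabola /= expr0n /=; lra.
have belowF : @below_parabola R `<=` connected_component (~` D) z0.
  exact: connected_component_max z0b belowD (@below_parabola_connected R).
exists (connected_component (~` D) z0); split.
- by exists z0 => //; exact: belowD.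
- move=> [M [Mreal HM]].
  have := HM (`|M| + 1); rewrite (le_lt_trans (ler_norm M)) ?ltrDl // => /(_ isT).
  have M0 : 0 <= `|M| by [].
  have Fz : connected_component (~` D) z0 (0, - (`|M| + 2)).
    by apply: belowF; rewrite /below_parabola /= expr0n /=; lra.
  move=> /(_ _ Fz) /=; rewrite prod_normE ge_max => /andP[_ /=]; rewrite normrN ger0_norm; lra.
move=> v; split.
  move=> B /nbhs_ballP[r /= r0 rB]; exists (x v, x v ^+ 2 - r / 2); split.
    by apply: belowF; rewrite /below_parabola /= ltrBlDr ltrDl divr_gt0.
  apply: rB; rewrite -ball_normE /= prod_normE gt_max /= subrr normr0 r0 /=.
  by rewrite opprB addrC subrK gtr0_norm; lra.
move/interior_subset/connected_component_sub; apply; left; by exists v.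
Qed.

End ConvexDrawing.

(** * Maximality and the two bounds *)

(** If no edge crossed uv, the ranks would stay noncrossing after adding uv, and the parabola
    drawing would contradict maximality. *)
Lemma maximal_outerplanar_crossed (R : realType) (T : finType) (e : rel T)
    (rk : T -> nat) u v :
  symmetric e -> irreflexive e -> injective rk -> noncrossing e rk ->
  maximal_outerplanar R e -> (rk u < rk v)%N -> ~~ e u v ->
  exists c d, e c d /\
    ([/\ rk c < rk u, rk u < rk d & rk d < rk v] \/
     [/\ rk u < rk c, rk c < rk v & rk v < rk d])%N.
Proof.
move=> e_sym e_irr rk_inj ncr [_ e_max] uv neuv.
have nuv : u != v by apply: contraTneq uv => ->; rewrite ltnn.
apply: contrapT => nocross; apply: (e_max u v nuv neuv).
apply: (@noncrossing_outerplanar R T _ rk) => //.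
- by move=> a b; rewrite /add_edge e_sym [(a == u) && _]andbC
    [(a == v) && _]andbC [X in _ || X]orbC.
- move=> a; rewrite /add_edge e_irr /=; apply/negbTE.
  by rewrite negb_or !negb_and; case: eqVneq => [->|_]; rewrite ?nuv //= orbT.
move=> a b c d /or3P[ab|/andP[/eqP-> /eqP->]|/andP[/eqP-> /eqP->]]
  /or3P[cd|/andP[/eqP-> /eqP->]|/andP[/eqP-> /eqP->]] [h1 h2 h3]; try lia.
- exact: (ncr a b c d).
- by apply: nocross; exists a, b; split=> //; left.
- by apply: nocross; exists c, d; split=> //; right.
Qed.

Theorem theorem6 (R : realType) (T : finType) (e : rel T)
    (e_sym : symmetric e) (e_irr : irreflexive e)
    (e_maxop : maximal_outerplanar R e) :
  (domination_number e)%:R <=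
    Num.min (3 * (packing_number e)%:R)
            (9 / 4 * (packing_number e)%:R + (num_degree_le e 3)%:R / 4) :> R.
Proof.
have [rk rk_inj ncr] := outerplanar_noncrossing (proj1 e_maxop).
have le2 : (domination_number e <= 2 * packing_number e)%N.
  apply: (domination_le_twice_packing e_sym (l := cover_length e rk)) => v.
  apply: cover_length_parents => // a b ab neab.
  exact: (maximal_outerplanar_crossed e_sym e_irr rk_inj ncr e_maxop).
have : (domination_number e)%:R <= 2 * (packing_number e)%:R :> R.
  by rewrite -natrM ler_nat.
have : 0 <= (packing_number e)%:R :> R by [].
have : 0 <= (num_degree_le e 3)%:R :> R by [].
(* Both bounds follow from the factor 2, which is at most 9/4 and 3. *)
by rewrite le_min => t0 r0 le; apply/andP; split; lra.
Qed.
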